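(* Let $A\in\mathbb{R}^{m\times n}$ have no zero rows, let $\omega\in(0,2)$, let $L$ be the lower triangular matrix defined in the context, and let $G = I - A^TL^{-1}A\in\mathbb{R}^{n\times n}$. Suppose that $G$ is diagonalizable (over $\mathbb{C}$), with eigenvalues $\lambda_1,\dots,\lambda_n$ (counted with multiplicity) labeled so that $|\lambda_n|\le\dots\le|\lambda_2|<|\lambda_1|<1$; in particular $\lambda_1$ is real and simple. Suppose moreover that $\lambda_1$ is nonnormal, and let $v_1$ and $\widetilde v_1$ denote normalized right and left eigenvectors of $G$ for $\lambda_1$, respectively. Let $b\in\mathbb{R}^m$ be such that the system $Ax=b$ is consistent, with solution $x^\star$. Let $x_k$ and $\widetilde x_k$ be the down-sweep and up-sweep Kaczmarz iterates for $Ax=b$, with errors $e_k=x_k-x^\star$ and $\widetilde e_k=\widetilde x_k-x^\star$. Suppose that the component $\gamma_1$ of $e_0$ in the direction of $v_1$ (in the expansion of $e_0$ in a basis of eigenvectors of $G$ containing $v_1$) is nonzero, and that the component $\widetilde\gamma_1$ of $\widetilde e_0$ in the direction of $\widetilde v_1$ (in the expansion of $\widetilde e_0$ in a basis of eigenvectors of $G^T$ containing $\widetilde v_1$) is nonzero. Then, as $k\to\infty$, $$\frac{\|x_k-\widetilde x_k\|}{\|e_k\|}=\frac{\|\gamma_1v_1-\widetilde\gamma_1\widetilde v_1\|}{|\gamma_1|}+\mathcal{O}\left(\left|\frac{\lambda_2}{\lambda_1}\right|^k\right),\qquad \frac{\|x_k-\widetilde x_k\|}{\|\widetilde e_k\|}=\frac{\|\gamma_1v_1-\widetilde\gamma_1\widetilde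 v_1\|}{|\widetilde\gamma_1|}+\mathcal{O}\left(\left|\frac{\lambda_2}{\lambda_1}\right|^k\right).$$ Moreover, the leading constants $\|\gamma_1v_1-\widetilde\gamma_1\widetilde v_1\|/|\gamma_1|$ and $\|\gamma_1v_1-\widetilde\gamma_1\widetilde v_1\|/|\widetilde\gamma_1|$ on the right-hand sides are nonzero.
   Context: $\|\cdot\|$ is the Euclidean norm. For $A\in\mathbb{R}^{m\times n}$ without zero rows and relaxation parameter $\omega\in(0,2)$, let $D=\mathrm{diag}(AA^T)$ be the diagonal part of $AA^T$, let $\mathrm{slt}(AA^T)$ be the strictly lower triangular part of $AA^T$, and set $L=\mathrm{slt}(AA^T)+\tfrac1\omega D$, which is invertible. The down-sweep Kaczmarz iteration for $Ax=b$ (one full cyclic sweep through the rows per iteration) is $x_{k+1}=x_k+A^TL^{-1}(b-Ax_k)$. The up-sweep Kaczmarz iteration (rows traversed in reverse order) is $\widetilde x_{k+1}=\widetilde x_k+A^TL^{-T}(b-A\widetilde x_k)$, so its iteration matrix is $I-A^TL^{-T}A=G^T$. A left eigenvector $\widetilde v$ of $G$ for $\lambda$ satisfies $\widetilde v^HG=\lambda\widetilde v^H$, $\widetilde v\neq0$. The condition number of a simple eigenvalue $\lambda$ with normalized (unit-norm) right and left eigenvectors $v,\widetilde v$ is $\kappa(\lambda)=|\widetilde v^Hv|^{-1}$; $\lambda$ is called normal if $\kappa(\lambda)=1$ and nonnormal otherwise. *)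

(* Defs.v *)
From mathcomp Require Import all_boot all_order all_algebra.
From mathcomp Require Import complex.
From mathcomp Require Import all_classical all_reals all_analysis.

Set Implicit Arguments.
Unset Strict Implicit.
Unset Printing Implicit Defensive.

Import Order.TTheory GRing.Theory Num.Theory.
Import numFieldNormedType.Exports.
Local Open Scope classical_set_scope.
Local Open Scope ring_scope.
Local Open Scope complex_scope.
Local Open Scope sesquilinear_scope.

(* Real matrices and vectors are viewed as complex ones through this map. *)
Definition toC (R : realType) (m n : nat) (M : 'M[R]_(m, n)) : 'M[R[i]]_(m, n) :=
  map_mx (fun a : R => a%:C) M.

(* The moduli [normc z] and the norm below take their values in [R], whereas
   the norm [`|z|] of [z : R[i]] lies in [R[i]]. *)
Definition enorm (R : realType) (n : nat) (v : 'cV[R[i]]_n) : R :=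
  Num.sqrt (\sum_(i < n) Normc.normc (v i 0) ^+ 2).

Definition slt_mx (R : realType) (n : nat) (M : 'M[R]_n) : 'M[R]_n :=
  \matrix_(i, j) if (j < i)%N then M i j else 0.

Definition diag_part (R : realType) (n : nat) (M : 'M[R]_n) : 'M[R]_n :=
  diag_mx (\row_i M i i).

Definition kaczmarz_L (R : realType) (m n : nat) (A : 'M[R]_(m, n)) (omega : R) :
    'M[R]_m :=
  slt_mx (A *m A^T) + omega^-1 *: diag_part (A *m A^T).

Definition kaczmarz_G (R : realType) (m n : nat) (A : 'M[R]_(m, n)) (omega : R) :
    'M[R]_n :=
  1%:M - A^T *m invmx (kaczmarz_L A omega) *m A.

Definition down_sweep (R : realType) (m n : nat) (A : 'M[R]_(m, n)) (omega : R)
    (b : 'cV[R]_m) (x0 : 'cV[R]_n) (k : nat) : 'cV[R]_n :=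
  iter k (fun x => x + A^T *m invmx (kaczmarz_L A omega) *m (b - A *m x)) x0.

Definition up_sweep (R : realType) (m n : nat) (A : 'M[R]_(m, n)) (omega : R)
    (b : 'cV[R]_m) (x0 : 'cV[R]_n) (k : nat) : 'cV[R]_n :=
  iter k (fun x => x + A^T *m (invmx (kaczmarz_L A omega))^T *m (b - A *m x)) x0.

(* MathComp's [eigenvalue] and [eigenspace] act on row vectors, without
   conjugation; eigenvectors are column vectors here. *)
Definition right_eigenvector (R : realType) (n : nat) (M : 'M[R[i]]_n)
    (l : R[i]) (v : 'cV[R[i]]_n) : Prop :=
  M *m v = l *: v /\ v != 0.

Definition left_eigenvector (R : realType) (n : nat) (M : 'M[R[i]]_n)
    (l : R[i]) (w : 'cV[R[i]]_n) : Prop :=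
  w ^t* *m M = l *: w ^t* /\ w != 0.

(* [v] and [w] are meant to be unit right and left eigenvectors for a common
   simple eigenvalue; the value does not depend on their choice. *)
Definition eig_cond (R : realType) (n : nat) (v w : 'cV[R[i]]_n) : R :=
  (Normc.normc ((w ^t* *m v) 0 0))^-1.

(* [g] is the coefficient of [v] in the expansion of [e] in some basis of
   eigenvectors of [M] (the columns of [V]) that contains [v]. *)
Definition eigen_component (R : realType) (n : nat) (M : 'M[R[i]]_n)
    (v e : 'cV[R[i]]_n) (g : R[i]) : Prop :=
  exists (V : 'M[R[i]]_n) (c : 'cV[R[i]]_n) (j : 'I_n),
    [/\ V \in unitmx,
        forall i : 'I_n, exists mu : R[i], right_eigenvector M mu (col i V),
        col j V = v,
        e = V *m c
      & c j 0 = g].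

(* Main.v *)
Require Import Defs.
From mathcomp Require Import all_boot all_order all_algebra.
From mathcomp Require Import complex.
From mathcomp Require Import all_classical all_reals all_analysis.
From mathcomp Require Import ring.

Set Implicit Arguments.
Unset Strict Implicit.
Unset Printing Implicit Defensive.

Import Order.TTheory GRing.Theory Num.Theory.
Import numFieldNormedType.Exports.
Local Open Scope classical_set_scope.
Local Open Scope ring_scope.
Local Open Scope sesquilinear_scope.
Import Normc.

(** Subtracting a solution [xstar] turns an affine sweep [x + B (b - A x)] into
    the linear map [1 - B A] acting on errors. So the down-sweep errors evolve
    under [G], and the up-sweep errors under [G^T], because transposing
    [A^T L^-1 A] transposes [L^-1] alone.

    In a basis of eigenvectors, [l1 ^- k G^k e0] is [gamma1 v1] plus terms of
    size [|mu / l1|^k], for [mu] the other eigenvalues (lemma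
    [power_iteration]). The eigenvalues belonging to the basis are exactly the
    roots of the characteristic polynomial, so only one of them is [l1] and the
    others have modulus at most [|l2|]. The same applies to [G^T], which has the
    same characteristic polynomial; its eigenvector [tv1] belongs to the
    conjugate of [l1], and that is [l1] itself, the only eigenvalue of its
    modulus. Hence both rescaled error sequences, and their difference, converge
    with rate [|l2 / l1|^k]. The norm is 1-Lipschitz, the factor [|l1|^k]
    cancels in the two ratios, and a quotient of two sequences converging at
    rate [g], the second to a positive limit, converges at rate [g]
    ([div_eqaddO]).

    The limits are nonzero: [gamma1 v1 = tgamma1 tv1] would make the unit
    vectors [v1] and [tv1] differ by a phase, and [l1] would be normal
    ([parallel_eig_cond]). *)

(** * The complex modulus and the Euclidean norm *)

Section Modulus.
Variable R : realType.
Implicit Types z : R[i].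

Lemma normc_ge0 z : 0 <= normc z.
Proof. by case: z => a b; apply: sqrtr_ge0. Qed.

Lemma normc_eq0 z : (normc z == 0) = (z == 0).
Proof. by apply/eqP/eqP => [/eq0_normc|->] //; apply: normc0. Qed.

Lemma normc_gt0 z : z != 0 -> 0 < normc z.
Proof. by rewrite lt_def normc_eq0 normc_ge0 andbT. Qed.

Lemma normcX z k : normc (z ^+ k) = normc z ^+ k.
Proof. by elim: k => [|k IHk]; rewrite ?normc1 // !exprS normcM IHk. Qed.

Lemma normc_conj z : normc z^* = normc z.
Proof. by apply: complexI; apply: norm_conjC. Qed.

End Modulus.

Section Norm.
Variables (R : realType) (n : nat).
Implicit Types u v : 'cV[R[i]]_n.

(** The link to the library's Hermitian forms on row vectors, from which the
    triangle inequality and definiteness are taken. *)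
Lemma enorm_dotmx u : (enorm u)%:C%C = sqrtC (dotmx u^T u^T).
Proof.
have -> : dotmx u^T u^T = (\sum_(i < n) normc (u i 0) ^+ 2)%:C%C.
  rewrite dotmxE mxE rmorph_sum; apply: eq_bigr => i _.
  by rewrite !mxE /= rmorphXn; symmetry; apply: normCK.
have s_ge0 : 0 <= \sum_(i < n) normc (u i 0) ^+ 2.
  by apply: sumr_ge0 => i _; apply: sqr_ge0.
by rewrite -[in RHS](sqr_sqrtr s_ge0) rmorphXn sqrCK // ler0c sqrtr_ge0.
Qed.

Lemma enorm_ge0 u : 0 <= enorm u.
Proof. exact: sqrtr_ge0. Qed.

Lemma enormD u v : enorm (u + v) <= enorm u + enorm v.
Proof.
rewrite -lecR rmorphD /= !enorm_dotmx linearD /=.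
exact: triangle_lerif.
Qed.

Lemma enormZ a u : enorm (a *: u) = normc a * enorm u.
Proof.
rewrite -[normc a]ger0_norm ?normc_ge0 // -sqrtr_sqr -sqrtrM ?sqr_ge0 //.
rewrite /enorm mulr_sumr; congr Num.sqrt; apply: eq_bigr => i _.
by rewrite mxE normcM exprMn.
Qed.

Lemma enormN u : enorm (- u) = enorm u.
Proof. by rewrite -scaleN1r enormZ normcN normc1 mul1r. Qed.

Lemma enorm0 : enorm (0 : 'cV[R[i]]_n) = 0.
Proof. by rewrite -(scale0r 0) enormZ normc0 mul0r. Qed.

Lemma enorm_eq0 u : (enorm u == 0) = (u == 0).
Proof.
by rewrite -(inj_eq (@complexI R)) enorm_dotmx sqrtC_eq0 dnorm_eq0 trmx_eq0.
Qed.

Lemma enorm_sum (I : finType) (P : pred I) (F : I -> 'cV[R[i]]_n) :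
  enorm (\sum_(i | P i) F i) <= \sum_(i | P i) enorm (F i).
Proof.
elim/big_ind2 : _ => // [|u a v c ua vc]; first by rewrite enorm0.
by apply: le_trans (enormD _ _) _; apply: lerD.
Qed.

Lemma enorm_lipschitz u v : `|enorm u - enorm v| <= enorm (u - v).
Proof.
have := enormD (v - u) u; have := enormD (u - v) v.
rewrite !subrK -[in enorm (v - u)]opprB enormN -!lerBlDr => uv vu.
by rewrite ler_norml uv andbT lerNl opprB.
Qed.

End Norm.

(** * Rates of convergence *)

(** By the identity
    [N / D - N0 / D0 = D^-1 ((N - N0) - N0 / D0 (D - D0))]
    it suffices that [D^-1] is bounded; eventually [D >= D0 / 2] because [g]
    tends to 0. *)
Lemma div_eqaddO (T : Type) (R : realType) (F : filter_on T) (N D g : T -> R)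
    (N0 D0 : R) :
  0 < D0 -> g @ F --> 0 ->
  N = cst N0 +O_F g -> D = cst D0 +O_F g ->
  (fun k => N k / D k) = cst (N0 / D0) +O_F g.
Proof.
move=> D0_gt0 g0 /eqaddOP/bigO_exP[a a_gt0 Na] /eqaddOP/bigO_exP[c c_gt0 Dc].
apply/eqaddOP/bigO_exP.
(* 2 / D0 bounds the inverse of the denominator, the rest the numerator. *)
exists (2 / D0 * (a + `|N0 / D0| * c)).
  by rewrite mulr_gt0 ?divr_gt0 // ltr_pwDl // mulr_ge0 // ltW.
have eps_gt0 : 0 < D0 / 2 / c by rewrite !divr_gt0.
have /cvgr0Pnorm_lt/(_ _ eps_gt0) gs := g0.
near=> k.
have gk : `|g k| < D0 / 2 / c by near: k.
have Nk : `|N k - N0| <= a * `|g k| by near: k.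
have Dk : `|D k - D0| <= c * `|g k| by near: k.
have Dge : D0 / 2 <= D k.
  have : `|D k - D0| <= D0 / 2.
    by apply: le_trans Dk _; rewrite mulrC -ler_pdivlMr // ltW.
  rewrite ler_norml => /andP[+ _]; rewrite lerBrDr; apply: le_trans.
  by rewrite addrC {2}(splitr D0) addrK.
have Dgt0 : 0 < D k by apply: lt_le_trans Dge; rewrite divr_gt0.
have -> : ((fun k => N k / D k) - cst (N0 / D0)) k =
          (D k)^-1 * ((N k - N0) - N0 / D0 * (D k - D0)).
  change (N k / D k - N0 / D0 = (D k)^-1 * ((N k - N0) - N0 / D0 * (D k - D0))).
  have Dk_neq0 : D k != 0 by rewrite gt_eqF.
  have D0_neq0 : D0 != 0 by rewrite gt_eqF.
  by field; rewrite D0_neq0.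
rewrite normrM -[leRHS]mulrA; apply: ler_pM => //.
  by rewrite gtr0_norm ?invr_gt0 // -(invf_div D0 2) lef_pV2 ?posrE ?divr_gt0.
apply: le_trans (ler_normB _ _) _; rewrite normrM mulrDl lerD //.
by rewrite -mulrA ler_wpM2l.
Unshelve. all: by end_near. Qed.

Lemma enorm_eqaddO (T : Type) (R : realType) n (F : filter_on T)
    (u : T -> 'cV[R[i]]_n) (u0 : 'cV[R[i]]_n) (g : T -> R) (C : R) :
  (forall k, enorm (u k - u0) <= C * g k) ->
  (fun k => enorm (u k)) = cst (enorm u0) +O_F g.
Proof.
move=> ug; apply/eqaddOP/bigO_exP.
(* The constant of a big O must be positive, and [C] need not be. *)
exists (`|C| + 1); first by rewrite ltr_wpDl.
apply: nearW => k; apply: le_trans (enorm_lipschitz _ _) _.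
apply: le_trans (ug k) _; apply: le_trans (ler_norm _) _.
by rewrite normrM ler_wpM2r // lerDl.
Qed.

(** * Powers of a matrix with a dominant eigenvalue *)

Section Spectrum.

(** The matrix is similar to the diagonal matrix of the [mu i], so these are its
    eigenvalues with their algebraic multiplicities. *)
Lemma char_poly_eigenbasis (F : fieldType) n (M V : 'M[F]_n) (mu : 'I_n -> F) :
  V \in unitmx -> (forall i, M *m col i V = mu i *: col i V) ->
  char_poly M = \prod_i ('X - (mu i)%:P).
Proof.
move=> Vunit MV; pose D := diag_mx (\row_i mu i).
have MVD : M *m V = V *m D.
  apply/matrixP => i j; have /colP/(_ i) := MV j.
  rewrite mul_mx_diag !mxE mulrC => <-; apply: eq_bigr => k _.
  by rewrite !mxE.
have /(congr1 determinant) : char_poly_mx M *m map_mx polyC V =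
                             map_mx polyC V *m char_poly_mx D.
  by rewrite mulmxBl mulmxBr -!map_mxM MVD scalar_mxC.
have detV_neq0 : \det (map_mx polyC V) != 0.
  by rewrite det_map_mx polyC_eq0 -unitfE -unitmxE.
rewrite !det_mulmx mulrC => /(mulfI detV_neq0) MD.
rewrite /char_poly MD -/(char_poly D) char_poly_trig ?diag_mx_is_trig //.
by apply: eq_bigr => i _; rewrite !mxE eqxx.
Qed.

Lemma mulmx_iter_eigenbasis (F : fieldType) n (M V : 'M[F]_n) (mu : 'I_n -> F)
    (c : 'cV[F]_n) k :
  (forall i, M *m col i V = mu i *: col i V) ->
  iter k (mulmx M) (V *m c) = \sum_i (mu i ^+ k * c i 0) *: col i V.
Proof.
move=> MV; elim: k => [|k IHk] /=.
  apply/colP => i; rewrite mxE summxE; apply: eq_bigr => j _.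
  by rewrite !mxE mul1r mulrC.
rewrite IHk mulmx_sumr; apply: eq_bigr => i _.
by rewrite -scalemxAr MV scalerA mulrAC -exprSr.
Qed.

Variable R : realType.
Implicit Types (s : seq R[i]) (z : R[i]).

Lemma normc_behead_le s z :
  sorted (fun z w => normc w <= normc z) s -> z \in behead s ->
  normc z <= normc s`_1.
Proof.
case: s => [|a [|b s]] //= /andP[_ ss]; rewrite inE => /predU1P[-> //|].
have tr : transitive (fun z w : R[i] => normc w <= normc z).
  by move=> x y w yx wx; apply: le_trans wx yx.
by move: (order_path_min tr ss) => /allP; apply.
Qed.

(** A dominant eigenvalue is determined by its modulus. For a real matrix this
    makes it real, its conjugate being an eigenvalue of the same modulus. *)
Lemma dominant_mem_eq s z :
  sorted (fun z w => normc w <= normc z) s -> normc s`_1 < normc s`_0 ->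
  z \in s -> normc z = normc s`_0 -> z = s`_0.
Proof.
move=> ss dom zs zE; have := @normc_behead_le s z ss.
case: s zs zE dom {ss} => // a s; rewrite inE => /predU1P[//|zs] zE dom.
by move/(_ zs); rewrite zE leNgt dom.
Qed.

(** Multiplicities matter: the index [j] accounts for one occurrence of the head
    of [s], so the other indices enumerate the tail, even where [mu] takes the
    value [mu j] again. *)
Lemma dominant_rest (I : finType) (mu : I -> R[i]) s (i j : I) :
  sorted (fun z w => normc w <= normc z) s ->
  perm_eq [seq mu i | i <- enum I] s -> mu j = s`_0 -> i != j ->
  normc (mu i) <= normc s`_1.
Proof.
move=> ss mus muj ij; apply: normc_behead_le => //.
have jI : j \in enum I by rewrite mem_enum.
have : perm_eq (mu j :: [seq mu i | i <- rem j (enum I)]) s.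
  by apply: perm_trans mus; rewrite perm_sym (perm_map mu (perm_to_rem jI)).
case: s muj {ss mus} => [_ /perm_size //|a s /= ->].
rewrite perm_cons => /perm_mem <-.
by apply: map_f; rewrite mem_rem_uniq ?enum_uniq // !inE ij mem_enum.
Qed.

(** After division by [l ^ k], the component along [v] is constant, and each of
    the others decays like a power of a ratio of modulus at most
    [|s`_1 / l|]. The eigenvalue [l] is only assumed to have dominant modulus,
    so that the lemma applies to [G^T] and the conjugate of [l1] before this is
    known to be [l1]. *)
Lemma power_iteration n (M : 'M[R[i]]_n) (s : seq R[i]) (l : R[i])
    (v e : 'cV[R[i]]_n) (g : R[i]) :
  char_poly M = \prod_(z <- s) ('X - z%:P) ->
  sorted (fun z w => normc w <= normc z) s -> normc s`_1 < normc s`_0 ->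
  right_eigenvector M l v -> normc l = normc s`_0 ->
  eigen_component M v e g ->
  l = s`_0 /\
  exists C : R, forall k,
    enorm (l ^- k *: iter k (mulmx M) e - g *: v) <= C * normc (s`_1 / l) ^+ k.
Proof.
move=> Ms ss dom [Mv v0] ls [V [c [j [Vunit MV Vj -> <-]]]].
have {MV} [mu MV] := choice MV.
have mus : perm_eq [seq mu i | i <- enum 'I_n] s.
  apply: prod_XsubC_eq.
  rewrite -Ms (char_poly_eigenbasis Vunit (fun i => (MV i).1)).
  by rewrite big_map big_enum.
have muj : mu j = l.
  have [MVj _] := MV j; move: MVj; rewrite Vj Mv => /eqP.
  by rewrite -subr_eq0 -scalerBl scaler_eq0 (negPf v0) orbF subr_eq0 => /eqP.
have lE : l = s`_0.
  apply: dominant_mem_eq => //.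
  by rewrite -(perm_mem mus) -muj map_f ?mem_enum.
have l_neq0 : l != 0.
  by rewrite -normc_eq0 ls gt_eqF // (le_lt_trans _ dom) ?normc_ge0.
split=> //; exists (\sum_(i | i != j) normc (c i 0) * enorm (col i V)) => k.
rewrite (mulmx_iter_eigenbasis _ _ (fun i => (MV i).1)) (bigD1 j) //= scalerDr.
rewrite muj Vj scalerA mulrA mulVf ?expf_neq0 // mul1r addrC addKr.
rewrite scaler_sumr mulr_suml; apply: le_trans (enorm_sum _ _) _.
apply: ler_sum => i ij; rewrite scalerA mulrA -exprVn -exprMn enormZ normcM.
rewrite normcX -mulrA mulrC ler_wpM2l ?mulr_ge0 ?normc_ge0 ?enorm_ge0 //.
rewrite lerXn2r ?nnegrE ?normc_ge0 // mulrC !normcM.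
by rewrite ler_wpM2r ?normc_ge0 // (dominant_rest ss mus _ ij) // muj.
Qed.

End Spectrum.

Lemma char_poly_tr (K : comNzRingType) n (M : 'M[K]_n) :
  char_poly M^T = char_poly M.
Proof.
rewrite /char_poly -det_tr /char_poly_mx linearB /= tr_scalar_mx.
by rewrite map_trmx trmxK.
Qed.

(** * Sweeps and their eigenvectors *)

Lemma iter_error (K : pzRingType) m n (A : 'M[K]_(m, n)) (B : 'M[K]_(n, m))
    (b : 'cV[K]_m) (xstar x0 : 'cV[K]_n) k :
  A *m xstar = b ->
  iter k (fun x => x + B *m (b - A *m x)) x0 - xstar =
    iter k (mulmx (1%:M - B *m A)) (x0 - xstar).
Proof.
move=> Axstar; elim: k => //= k <-; move: (iter _ _ _) => x.
rewrite -Axstar mulmxBl mul1mx -mulmxA -mulmxBr -(opprB x) !mulmxN.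
by rewrite addrAC.
Qed.

Section Complexification.
Variable R : realType.

Lemma toC_iter_mulmx n (M : 'M[R]_n) (e : 'cV[R]_n) k :
  toC (iter k (mulmx M) e) = iter k (mulmx (toC M)) (toC e).
Proof. by elim: k => //= k <-; apply: map_mxM. Qed.

(** For a real matrix, conjugate transposition is plain transposition on the
    matrix but conjugates the eigenvalue. *)
Lemma left_eigenvector_tr n (M : 'M[R]_n) l (w : 'cV[R[i]]_n) :
  left_eigenvector (toC M) l w -> right_eigenvector (toC M)^T l^* w.
Proof.
case=> wM w_neq0; split=> //.
have adj2 : w ^t* ^t* = w.
  by apply/matrixP => i j; rewrite !mxE conjCK.
have adjM : (toC M) ^t* = (toC M)^T.
  apply/matrixP => i j; rewrite !mxE; apply/CrealP/complex_realP.
  by exists (M j i).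
have /(congr1 (fun u => u ^t*)) := wM.
rewrite trmx_mul map_mxM adj2 adjM => ->.
by rewrite linearZ /= map_mxZ adj2.
Qed.

Lemma enorm_sqr n (w : 'cV[R[i]]_n) :
  (w ^t* *m w) 0 0 = (enorm w ^+ 2)%:C%C.
Proof.
rewrite rmorphXn /= enorm_dotmx sqrtCK dotmxE !mxE.
by apply: eq_bigr => i _; rewrite !mxE mulrC.
Qed.

(** The vectors differ by a scalar of modulus 1, so that their inner product has
    modulus 1. *)
Lemma parallel_eig_cond n (v w : 'cV[R[i]]_n) (a c : R[i]) :
  enorm v = 1 -> enorm w = 1 -> a != 0 -> a *: v = c *: w -> eig_cond v w = 1.
Proof.
move=> v1 w1 a_neq0 /(congr1 ( *:%R a^-1)).
rewrite !scalerA mulVf // scale1r => vE.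
rewrite /eig_cond vE -scalemxAr mxE enorm_sqr w1 expr1n mulr1.
by have := v1; rewrite vE enormZ w1 mulr1 => ->; rewrite invr1.
Qed.

End Complexification.

Theorem proposition3p1 (R : realType) (m n : nat) (A : 'M[R]_(m, n)) (omega : R)
    (lambda : n.-tuple R[i]) (v1 tv1 : 'cV[R[i]]_n)
    (b : 'cV[R]_m) (xstar x0 tx0 : 'cV[R]_n) (gamma1 tgamma1 : R[i]) :
  let G : 'M[R[i]]_n := toC (kaczmarz_G A omega) in
  let l1 : R[i] := lambda`_0 in
  let l2 : R[i] := lambda`_1 in
  let x := down_sweep A omega b x0 in
  let tx := up_sweep A omega b tx0 in
  let e := fun k : nat => x k - xstar in
  let te := fun k : nat => tx k - xstar in
  let delta : R := enorm (gamma1 *: v1 - tgamma1 *: tv1) in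
  (forall i : 'I_m, row i A != 0) ->
  0 < omega < 2 ->
  diagonalizable G ->
  char_poly G = \prod_(l <- lambda) ('X - l%:P) ->
  sorted (fun z w : R[i] => Normc.normc w <= Normc.normc z) lambda ->
  Normc.normc l2 < Normc.normc l1 < 1 ->
  right_eigenvector G l1 v1 -> enorm v1 = 1 ->
  left_eigenvector G l1 tv1 -> enorm tv1 = 1 ->
  eig_cond v1 tv1 <> 1 ->
  A *m xstar = b ->
  eigen_component G v1 (toC (e 0%N)) gamma1 -> gamma1 != 0 ->
  eigen_component G^T tv1 (toC (te 0%N)) tgamma1 -> tgamma1 != 0 ->
  [/\ (fun k : nat => enorm (toC (x k - tx k)) / enorm (toC (e k)))
        = cst (delta / Normc.normc gamma1)
          +O_\oo (fun k : nat => Normc.normc (l2 / l1) ^+ k),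
      (fun k : nat => enorm (toC (x k - tx k)) / enorm (toC (te k)))
        = cst (delta / Normc.normc tgamma1)
          +O_\oo (fun k : nat => Normc.normc (l2 / l1) ^+ k),
      delta / Normc.normc gamma1 != 0
    & delta / Normc.normc tgamma1 != 0].
Proof.
move=> G l1 l2 x tx e te delta _ _ _ charG lsorted /andP[dom _].
move=> Gv1 v1_unit Gtv1 tv1_unit nonnormal Axstar e0 g1 te0 tg1.
have [_ [C vC]] := power_iteration charG lsorted dom Gv1 erefl e0.
have charGT : char_poly G^T = \prod_(l <- lambda) ('X - l%:P).
  by rewrite char_poly_tr.
have [l1conj [tC tvC]] := power_iteration charGT lsorted dom
  (left_eigenvector_tr Gtv1) (normc_conj _) te0.
move: tvC; rewrite l1conj -/l1 -/l2 => tvC.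
have eE k : toC (e k) = iter k (mulmx G) (toC (e 0%N)).
  by rewrite -toC_iter_mulmx /e /x /down_sweep iter_error.
have teE k : toC (te k) = iter k (mulmx G^T) (toC (te 0%N)).
  rewrite map_trmx -toC_iter_mulmx /te /tx /up_sweep iter_error //.
  by rewrite /kaczmarz_G linearB /= trmx1 !trmx_mul trmxK mulmxA.
have l1_gt0 : 0 < normc l1 by apply: le_lt_trans dom; apply: normc_ge0.
pose r := normc (l2 / l1).
have r_cvg : (fun k => r ^+ k) @ \oo --> (0 : R).
  apply: cvg_expr; rewrite ger0_norm ?normc_ge0 // /r normcM normcV.
  by rewrite ltr_pdivrMr // mul1r.
pose p k := l1 ^- k *: toC (e k); pose tp k := l1 ^- k *: toC (te k).
have pC k : enorm (p k - gamma1 *: v1) <= C * r ^+ k by rewrite /p eE.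
have tpC k : enorm (tp k - tgamma1 *: tv1) <= tC * r ^+ k by rewrite /tp teE.
have dC k : enorm (p k - tp k - (gamma1 *: v1 - tgamma1 *: tv1))
            <= (C + tC) * r ^+ k.
  rewrite opprD addrACA -opprD.
  by apply: le_trans (enormD _ _) _; rewrite enormN mulrDl lerD.
have scale k (u : 'cV_n) w :
    enorm u / enorm w = enorm (l1 ^- k *: u) / enorm (l1 ^- k *: w).
  rewrite !enormZ invfM mulrACA divff ?mul1r //.
  by rewrite normc_eq0 invr_eq0 expf_neq0 // -normc_eq0 gt_eqF.
have xtx k : l1 ^- k *: toC (x k - tx k) = p k - tp k.
  rewrite -scalerBr; congr (_ *: _).
  by rewrite -map_mxB /e /te opprB addrA subrK.
have g1_norm : enorm (gamma1 *: v1) = normc gamma1.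
  by rewrite enormZ v1_unit mulr1.
have tg1_norm : enorm (tgamma1 *: tv1) = normc tgamma1.
  by rewrite enormZ tv1_unit mulr1.
have delta_neq0 : delta != 0.
  rewrite enorm_eq0 subr_eq0; apply/eqP => vtv; apply: nonnormal.
  exact: parallel_eig_cond vtv.
have ratioE (u : nat -> 'cV[R]_n) :
    (fun k => enorm (toC (x k - tx k)) / enorm (toC (u k))) =
    (fun k => enorm (p k - tp k) / enorm (l1 ^- k *: toC (u k))).
  by apply/funext => k; rewrite -xtx; apply: scale.
split; rewrite ?ratioE.
- apply: (div_eqaddO (normc_gt0 g1) r_cvg); first exact: enorm_eqaddO dC.
  by rewrite -g1_norm; apply: enorm_eqaddO pC.
- apply: (div_eqaddO (normc_gt0 tg1) r_cvg); first exact: enorm_eqaddO dC.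
  by rewrite -tg1_norm; apply: enorm_eqaddO tpC.
- by rewrite mulf_neq0 // invr_eq0 normc_eq0.
- by rewrite mulf_neq0 // invr_eq0 normc_eq0.
Qed.
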